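(* Let $f,h,g$ satisfy the standing assumptions (A1)–(A5) of the context, and let $L_h>0$ be the Lipschitz constant of $\nabla h$ in (A2). Suppose that $\sum_{k=0}^{\infty}\varepsilon_k<+\infty$ and that there exist $\underline{\gamma},\overline{\gamma}>0$ such that $\frac{L_h}{2}<\underline{\gamma}\leq\overline{\gamma}$ and $\underline{\gamma}I_n\preceq H_k\preceq\overline{\gamma}I_n$ for all $k\geq0$. Let $\{\bm{x}^k\}$ be a sequence generated by the iVPGSA described in the context. Then any accumulation point of $\{\bm{x}^k\}$ is a critical point of $F$.
   Context: Notation. $\|\cdot\|$ is the Euclidean norm; for a symmetric matrix $M$, $\|\bm{v}\|_M^2:=\langle \bm{v},M\bm{v}\rangle$; $I_n$ is the $n\times n$ identity; $\preceq$ is the Loewner order. For a proper closed convex function $f$, $\delta\ge 0$ and $\bm{x}\in\mathrm{dom}\,f$, $\partial_\delta f(\bm{x}):=\{\bm{d}: f(\bm{y})\ge f(\bm{x})+\langle \bm{d},\bm{y}-\bm{x}\rangle-\delta\ \ \forall \bm{y}\in\mathbb{R}^n\}$, and $\partial f=\partial_0 f$. Problem. Consider $\min_{\bm{x}\in\Omega}\frac{f(\bm{x})+h(\bm{x})}{g(\bm{x})}$, where $\Omega:=\{\bm{x}\in\mathbb{R}^n: g(\bm{x})\neq0\}$ is nonempty, and define $F(\bm{x}):=\frac{f(\bm{x})+h(\bm{x})}{g(\bm{x})}$ if $\bm{x}\in\mathrm{dom}\,f\cap\Omega$, and $F(\bm{x}):=+\infty$ otherwise. Standing assumptions. (A1)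 $f:\mathbb{R}^n\to\mathbb{R}\cup\{+\infty\}$ is proper, closed and convex. (A2) $h:\mathbb{R}^n\to\mathbb{R}$ is continuously differentiable (possibly nonconvex) and there is $L_h>0$ with $\|\nabla h(\bm{x})-\nabla h(\bm{y})\|\le L_h\|\bm{x}-\bm{y}\|$ for all $\bm{x},\bm{y}$. (A3) $g:\mathbb{R}^n\to\mathbb{R}$ is continuous, convex, and nonnegative over $\mathrm{dom}\,f$. (A4) $f+h$ is nonnegative on $\mathrm{dom}\,f$, and $f(\bm{x})+h(\bm{x})>0$ when $g(\bm{x})=0$. (A5) $F$ is level-bounded: for every $\alpha\in\mathbb{R}$ the set $\{\bm{x}:F(\bm{x})\le\alpha\}$ is bounded (possibly empty). Algorithm (iVPGSA). Input: $\bm{x}^0\in\Omega\cap\mathrm{dom}\,f$, nonnegative scalars $\{\varepsilon_k\}_{k\ge0}$, symmetric positive definite matrices $\{H_k\}_{k\ge0}\subset\mathbb{R}^{n\times n}$. For each $k=0,1,2,\dots$: set $c_k=\frac{f(\bm{x}^k)+h(\bm{x}^k)}{g(\bm{x}^k)}$ and take any $\bm{y}^k\in\partial g(\bm{x}^k)$; find $\bm{x}^{k+1}\in\Omega\cap\mathrm{dom}\,f$ and an error pair $(\Delta^k,\delta_k)\in\mathbb{R}^n\times[0,\infty)$ such that $$\Delta^k\in\partial_{\delta_k}f(\bm{x}^{k+1})+\nabla h(\bm{x}^k)-c_k\bm{y}^k+H_k(\bm{x}^{k+1}-\bm{x}^k)$$ and $$\|\Delta^k\|^2+|\langle\Delta^k,\bm{x}^{k+1}-\bm{x}^k\rangle|+\delta_k\le\varepsilon_k\,g(\bm{x}^{k+1}).$$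 The generated sequence $\{\bm{x}^k\}_{k\ge 0}$ is infinite. Critical point. $\bm{x}^*\in\mathrm{dom}\,F$ is a critical point of $F$ if, with $c^*=F(\bm{x}^* )$, $0\in\partial f(\bm{x}^* )+\nabla h(\bm{x}^* )-c^*\partial g(\bm{x}^* )$. *)

(* Defs.v *)
From HB Require Import structures.
From mathcomp Require Import all_boot all_order all_algebra.
From mathcomp Require Import all_classical all_reals all_analysis.
Import Order.TTheory GRing.Theory Num.Theory.
Import numFieldNormedType.Exports.

Set Implicit Arguments.
Unset Strict Implicit.
Unset Printing Implicit Defensive.

Local Open Scope classical_set_scope.
Local Open Scope ring_scope.

(* Vectors of R^n are rows, so the product of a matrix [M] with a vector [v]
   is [v *m M^T].  The library norm on ['rV[R]_n] is the max norm; it is only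
   used through the topology, boundedness and differentiability it induces. *)

Section Euclidean.
Context {R : realType} {n : nat}.
Implicit Types (u v : 'rV[R]_n) (M A B : 'M[R]_n).

Definition dotp u v : R := \sum_(i < n) u 0 i * v 0 i.

Definition enorm v : R := Num.sqrt (dotp v v).

Definition posdefmx M : Prop :=
  M \is symmetricmx /\ forall v, v != 0 -> 0 < dotp v (v *m M^T).

Definition possemidefmx M : Prop :=
  M \is symmetricmx /\ forall v, 0 <= dotp v (v *m M^T).

Definition loewner_le A B : Prop := possemidefmx (B - A).

Definition gradient (h : 'rV[R]_n -> R) (x : 'rV[R]_n) : 'rV[R]_n :=
  \row_(j < n) 'D_(delta_mx 0 j) h x.

Definition continuously_differentiable (h : 'rV[R]_n -> R) : Prop :=
  (forall x, differentiable h x) /\ continuous (gradient h).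

End Euclidean.

Section ExtendedFunctions.
Context {R : realType} {n : nat}.
Implicit Types f : 'rV[R]_n -> \bar R.

Definition edom f : set 'rV[R]_n := [set x | (f x < +oo)%E].

Definition proper_fun f : Prop := (forall x, (-oo < f x)%E) /\ edom f !=set0.

Definition closed_fun f : Prop :=
  closed [set p : 'rV[R]_n * R | (f p.1 <= p.2%:E)%E].

(* For [t = 0] or [t = 1] this relies on [0 * +oo = 0]; the right-hand side
   is never [+oo - oo] because the definition is only used for [f > -oo]. *)
Definition econvex f : Prop :=
  forall x y (t : R), 0 <= t <= 1 ->
    (f (t *: x + (1 - t) *: y)%R <= t%:E * f x + (1 - t)%:E * f y)%E.

(* Meaningful for [x \in edom f]. *)
Definition eps_subdiff f (delta : R) (x : 'rV[R]_n) : set 'rV[R]_n :=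
  [set d | forall y, (f x + (dotp d (y - x))%:E - delta%:E <= f y)%E].

Definition subdiff f (x : 'rV[R]_n) : set 'rV[R]_n := eps_subdiff f 0 x.

End ExtendedFunctions.

Section FractionalProgram.
Context {R : realType} {n : nat}.
Variables (f : 'rV[R]_n -> \bar R) (h g : 'rV[R]_n -> R).

Definition Omega : set 'rV[R]_n := [set x | g x != 0].

(* The quotient (f + h) / g, meaningful on [edom f `&` Omega]. *)
Definition ratio (x : 'rV[R]_n) : R := (fine (f x) + h x) / g x.

Definition objective (x : 'rV[R]_n) : \bar R :=
  if `[< (edom f `&` Omega) x >] then (ratio x)%:E else +oo%E.

Definition level_bounded (F : 'rV[R]_n -> \bar R) : Prop :=
  forall a : R, bounded_set [set x | (F x <= a%:E)%E].

Definition critical_point (x : 'rV[R]_n) : Prop :=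
  edom objective x /\
  exists u v, [/\ subdiff f x u, subdiff (EFin \o g) x v &
    0 = u + gradient h x - fine (objective x) *: v].

Definition iVPGSA_step (eps : R) (H : 'M[R]_n) (x x' : 'rV[R]_n) : Prop :=
  exists (y Delta : 'rV[R]_n) (delta : R),
  [/\ subdiff (EFin \o g) x y,
      (Omega `&` edom f) x',
      0 <= delta,
      [set d + gradient h x - ratio x *: y + (x' - x) *m H^T
         | d in eps_subdiff f delta x'] Delta &
      enorm Delta ^+ 2 + `|dotp Delta (x' - x)| + delta <= eps * g x'].

Definition iVPGSA_sequence (eps : nat -> R) (H : nat -> 'M[R]_n)
    (x : nat -> 'rV[R]_n) : Prop :=
  (Omega `&` edom f) (x 0%N) /\
  forall k, iVPGSA_step (eps k) (H k) (x k) (x k.+1).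

End FractionalProgram.

(* Main.v *)
Require Import Defs.
From HB Require Import structures.
From mathcomp Require Import all_boot all_order all_algebra.
From mathcomp Require Import all_classical all_reals all_analysis.
From mathcomp Require Import ring lra.
Import Order.TTheory GRing.Theory Num.Theory.
Import numFieldNormedType.Exports.

Local Open Scope classical_set_scope.
Local Open Scope ring_scope.

(** With [c_k] the ratio at the iterate [x_k] and [s_k = x_{k+1} - x_k], the
    inclusion that defines a step, combined with the descent lemma for [h] and
    with the subgradient inequalities for [f] and [g], yields
    [c_{k+1} + (gamma_lo - Lh / 2) |s_k|^2 / g x_{k+1} <= c_k + eps_k]
    ([step_decrease]).  As the [eps_k] are summable and [c_k >= 0], the ratios
    converge to some [c*] and the slack terms vanish ([quasi_decrease_cvg]).
    The ratios being bounded, level-boundedness makes the iterates bounded;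
    hence [g x_k] is bounded and [s_k], [H_k s_k], [Delta_k] and [delta_k] all
    tend to 0, while the subgradients [y_k] of [g] stay bounded
    ([subdiff_bounded]).

    Given an accumulation point [x*], the filter [\oo] is refined
    ([cluster_finer]) so that [x_k] tends to [x*] and [y_k] to some [y*], which
    is a subgradient of [g] at [x*] ([subdiff_closed]); [x_{k+1}] then also
    tends to [x*].  The approximate subgradients of [f] at [x_{k+1}] converge
    to [c* y* - grad h x*], and
    [f x_{k+1} = c_{k+1} g x_{k+1} - h x_{k+1}] converges as well, so
    [eps_subdiff_closed] shows that the limit is a subgradient of [f] at [x*]
    and that [f x* = c* g x* - h x*].  If [g x*] were 0, then [f + h] would
    vanish at [x*], against its positivity there; so [c*] is the value of the
    objective at [x*], and [x*] is critical. *)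

(** * The Euclidean inner product and Loewner bounds *)

Section Dotp.
Context {R : realType} {n : nat}.
Implicit Types (u v w s : 'rV[R]_n) (M : 'M[R]_n).

Lemma dotpC u v : dotp u v = dotp v u.
Proof. by apply: eq_bigr => i _; rewrite mulrC. Qed.

Lemma dotpDl u v w : dotp (u + v) w = dotp u w + dotp v w.
Proof. by rewrite -big_split; apply: eq_bigr => i _; rewrite mxE mulrDl. Qed.

Lemma dotpZl a u w : dotp (a *: u) w = a * dotp u w.
Proof. by rewrite mulr_sumr; apply: eq_bigr => i _; rewrite mxE mulrA. Qed.

Lemma dotpNl u w : dotp (- u) w = - dotp u w.
Proof. by rewrite -scaleN1r dotpZl mulN1r. Qed.

Lemma dotpBl u v w : dotp (u - v) w = dotp u w - dotp v w.
Proof. by rewrite dotpDl dotpNl. Qed.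

Lemma dotpDr w u v : dotp w (u + v) = dotp w u + dotp w v.
Proof. by rewrite dotpC dotpDl !(dotpC w). Qed.

Lemma dotpZr a w u : dotp w (a *: u) = a * dotp w u.
Proof. by rewrite dotpC dotpZl (dotpC w). Qed.

Lemma dotpNr w u : dotp w (- u) = - dotp w u.
Proof. by rewrite dotpC dotpNl (dotpC w). Qed.

Lemma dotpBr w u v : dotp w (u - v) = dotp w u - dotp w v.
Proof. by rewrite dotpDr dotpNr. Qed.

Lemma dotp0r w : dotp w 0 = 0.
Proof. by rewrite -[X in dotp _ X](scale0r (0 : 'rV[R]_n)) dotpZr mul0r. Qed.

Lemma dotp_ge0 u : 0 <= dotp u u.
Proof. by apply: sumr_ge0 => i _; rewrite -expr2 sqr_ge0. Qed.

Lemma dotp_delta u i : dotp u (delta_mx 0 i) = u 0 i.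
Proof.
rewrite /dotp (bigD1 i)//= mxE !eqxx mulr1 big1 ?addr0// => j ji.
by rewrite mxE (negbTE ji) andbF mulr0.
Qed.

Lemma dotp_mulmx u v M : dotp u (v *m M^T) = dotp (u *m M) v.
Proof.
have dotpE (a b : 'rV[R]_n) : dotp a b = (a *m b^T) 0 0.
  by rewrite mxE; apply: eq_bigr => i _; rewrite mxE.
by rewrite !dotpE trmx_mul trmxK mulmxA.
Qed.

Lemma enorm_ge0 u : 0 <= enorm u.
Proof. exact: sqrtr_ge0. Qed.

Lemma enorm_sqr u : enorm u ^+ 2 = dotp u u.
Proof. by rewrite sqr_sqrtr// dotp_ge0. Qed.

(** A form of the Cauchy-Schwarz inequality that follows from the
    nonnegativity of [dotp (u - a *: s) (u - a *: s)]. *)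
Lemma dotp_le_of_enorm_le a u s : 0 < a -> enorm u <= a * enorm s ->
  dotp u s <= a * dotp s s.
Proof.
move=> a0 us.
have : enorm u ^+ 2 <= (a * enorm s) ^+ 2.
  by rewrite ler_sqr// nnegrE ?enorm_ge0// mulr_ge0 ?enorm_ge0 ?ltW.
rewrite exprMn !enorm_sqr => us2.
have := dotp_ge0 (u - a *: s).
rewrite dotpBl !dotpBr !dotpZl !dotpZr (dotpC s u) => h.
rewrite -(ler_pM2l a0); nra.
Qed.

Lemma normr_row_attained u : u != 0 -> exists j, `|u| = `|u 0 j|.
Proof.
move=> u0; have [[i j] /= ->] : exists i : 'I_1 * 'I_n, `|u| = `|u i.1 i.2|.
  by apply: mx_norm_neq0; rewrite -[mx_norm u]/`|u| normr_eq0.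
by exists j; rewrite ord1.
Qed.

(** The max norm, which carries the topology, is dominated by the Euclidean
    one; estimates on [dotp v v] hence yield convergence of vectors. *)
Lemma normr_le_enorm u : `|u| <= enorm u.
Proof.
have [->|u0] := eqVneq u 0; first by rewrite normr0 enorm_ge0.
have [j ->] := normr_row_attained _ u0.
rewrite -sqrtr_sqr ler_wsqrtr// /dotp (bigD1 j)//= expr2 lerDl.
by apply: sumr_ge0 => k _; rewrite -expr2 sqr_ge0.
Qed.

Lemma loewner_lower gam M s :
  loewner_le gam%:M M -> gam * dotp s s <= dotp s (s *m M^T).
Proof.
move=> [_ /(_ s)].
rewrite linearB/= mulmxBr dotpBr tr_scalar_mx mul_mx_scalar dotpZr.
by rewrite subr_ge0.
Qed.

Lemma loewner_upper gam M s :
  loewner_le M gam%:M -> dotp s (s *m M^T) <= gam * dotp s s.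
Proof.
move=> [_ /(_ s)].
rewrite linearB/= mulmxBr dotpBr tr_scalar_mx mul_mx_scalar dotpZr.
by rewrite subr_ge0.
Qed.

(** If [0 < M <= gam], then [M] has operator norm at most [gam].  Testing the
    nonnegativity of the quadratic form of [M] at [M s - gam s] gives
    [|M s|^2 <= gam * <s, M s>], without any spectral decomposition. *)
Lemma posdef_mulmx_le gam M s : 0 < gam -> posdefmx M ->
  loewner_le M gam%:M ->
  dotp (s *m M^T) (s *m M^T) <= gam ^+ 2 * dotp s s.
Proof.
move=> gam0 [Msym Mpos] Mgam.
have MT : M^T = M.
  apply/esym; move: Msym => /is_hermitianmxP; rewrite expr0 scale1r => {1}->.
  by apply/matrixP => i j; rewrite !mxE.
have Mge0 v : 0 <= dotp v (v *m M^T).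
  have [->|/Mpos/ltW//] := eqVneq v 0.
  by rewrite mul0mx /dotp big1// => i _; rewrite mxE mul0r.
set w := s *m M^T.
have := Mge0 (w - gam *: s); have := loewner_upper _ _ w Mgam.
have := loewner_upper _ _ s Mgam.
rewrite mulmxBl dotpBl !dotpBr -scalemxAl !dotpZl !dotpZr -/w.
have -> : dotp s (w *m M^T) = dotp w w.
  by rewrite dotp_mulmx /w MT.
have := dotp_ge0 s; have := dotp_ge0 w.
move: (dotp w (w *m M^T)) (dotp w w) (dotp s w) (dotp s s) => a b c d.
nra.
Qed.

(** * Smooth functions along lines *)

Lemma derive_dotp (h : 'rV[R]_n -> R) x v :
  differentiable h x -> 'D_v h x = dotp (gradient h x) v.
Proof.
move=> dh; rewrite deriveE// [in LHS](row_sum_delta v) linear_sum.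
by apply: eq_bigr => i _; rewrite linearZ/= mxE deriveE// mulrC.
Qed.

Lemma is_derive_line (h : 'rV[R]_n -> R) x s (t : R) :
  differentiable h (x + t *: s) ->
  is_derive t 1 (fun r : R => h (x + r *: s))
    (dotp (gradient h (x + t *: s)) s).
Proof.
move=> dh; rewrite -derive_dotp//.
have E : (fun r : R => r^-1 *:
     (((fun r : R => h (x + r *: s)) \o shift t) (r *: 1) - h (x + t *: s))) =
   (fun r : R => r^-1 *: ((h \o shift (x + t *: s)) (r *: s) - h (x + t *: s))).
  apply/funext => r /=; congr (_ *: (h _ - _)).
  by rewrite scalerDl -scalerA scale1r addrCA.
split; first by rewrite /derivable E; exact: diff_derivable.
by rewrite /derive E.
Qed.

(** The quadratic upper bound of a function with Lipschitz gradient. *)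
Lemma descent_lemma (h : 'rV[R]_n -> R) (L : R) :
  (forall x, differentiable h x) -> 0 < L ->
  (forall x y, enorm (gradient h x - gradient h y) <= L * enorm (x - y)) ->
  forall x s, h (x + s) <= h x + dotp (gradient h x) s + L / 2 * dotp s s.
Proof.
move=> dh L0 hL x s.
(* It suffices that the gap between [h] and its quadratic model, restricted to
   the segment from [x] to [x + s], is nonincreasing on [0, 1]. *)
pose G := dotp (gradient h x) s; pose N := L / 2 * dotp s s.
pose phi (t : R) : R := h (x + t *: s) - (t * G + t ^+ 2 * N).
have dphi (t : R) : is_derive t 1 phi
    (dotp (gradient h (x + t *: s)) s - (G + 2 * t * N)).
  have := is_derive_line _ _ s t (dh _) => ?.
  have d2 : is_derive t 1 (G *: (@id R : R -> R) + N *: (@id R : R -> R) ^+ 2)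
      (G + 2 * t * N).
    by apply: is_derive_eq; rewrite /GRing.scale/= expr1; ring.
  have -> : phi = (fun r : R => h (x + r *: s)) -
      (G *: (@id R : R -> R) + N *: (@id R : R -> R) ^+ 2).
    apply/funext => r; rewrite /phi !fctE /GRing.scale/=; ring.
  exact: is_deriveB.
suff : phi 1 <= phi 0.
  by rewrite /phi scale1r scale0r addr0 /G /N; lra.
apply: (@ler0_derive1_nincr _ phi 0 1) => //.
- move=> t; rewrite in_itv/= => /andP[t0 _].
  rewrite derive1E (@derive_val _ _ _ _ _ _ _ (dphi t)).
  have Lt : 0 < L * t by rewrite mulr_gt0.
  have -> : dotp (gradient h (x + t *: s)) s - (G + 2 * t * N) =
      dotp (gradient h (x + t *: s) - gradient h x) s - L * t * dotp s s.
    by rewrite dotpBl /G /N; field.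
  rewrite subr_le0; apply: dotp_le_of_enorm_le => //.
  apply: (le_trans (hL _ _)); rewrite addrAC subrr add0r -mulrA ler_pM2l//.
  rewrite /enorm dotpZl dotpZr mulrA -expr2 sqrtrM ?sqr_ge0//.
  by rewrite sqrtr_sqr gtr0_norm.
- apply: continuous_subspaceT => t.
  exact/differentiable_continuous/derivable1_diffP.
Qed.

End Dotp.

(** * Almost decreasing sequences and refinements of filters *)

Section Sequences.
Context {R : realType}.

Lemma summable_series_bounded (eps : nat -> R) : (forall k, 0 <= eps k) ->
  (\sum_(0 <= k <oo) (eps k)%:E < +oo)%E ->
  exists S : R, forall m, series eps m <= S.
Proof.
move=> eps0 epsoo.
have eps0' k : (0 <= (eps k)%:E)%E by rewrite lee_fin.
exists (fine (\sum_(0 <= k <oo) (eps k)%:E)) => m.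
rewrite -lee_fin fineK.
  rewrite /series/= -sumEFin.
  by apply: nneseries_lim_ge => k _ _; exact: eps0'.
by rewrite ge0_fin_numE//; apply: nneseries_ge0 => k _ _; exact: eps0'.
Qed.

(** A nonnegative sequence that decreases up to summable errors converges,
    because it becomes nonincreasing once the partial sums of the errors are
    subtracted; the slack [r] of the inequality then vanishes. *)
Lemma quasi_decrease_cvg (c r eps : nat -> R) : (forall k, 0 <= c k) ->
  (forall k, 0 <= r k) -> (forall k, 0 <= eps k) ->
  (\sum_(0 <= k <oo) (eps k)%:E < +oo)%E ->
  (forall k, c k.+1 + r k <= c k + eps k) ->
  [/\ cvgn c, eps @ \oo --> 0, r @ \oo --> 0 &
      exists C, forall k, c k <= C].
Proof.
move=> c0 r0 eps0 epsoo dec.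
have [S epsS] := summable_series_bounded _ eps0 epsoo.
have S_incr : nondecreasing_seq (series eps).
  by apply/nondecreasing_seqP => k; rewrite seriesSr lerDl.
have S_cvg : cvgn (series eps).
  by apply: nondecreasing_is_cvgn => //; exists S => _ [k _ <-].
have eps_cvg : eps @ \oo --> 0 := cvg_series_cvg_0 S_cvg.
have d_noninc k : c k.+1 - series eps k.+1 <= c k - series eps k.
  by rewrite seriesSr; have := dec k; have := r0 k; lra.
have d_decr : nonincreasing_seq (fun k => c k - series eps k).
  exact/nonincreasing_seqP.
have d_cvg : cvgn (fun k => c k - series eps k).
  apply: nonincreasing_is_cvgn => //; exists (- S) => _ [k _ <-].
  by have := c0 k; have := epsS k; lra.
have c_cvg : cvgn c.
  have -> : c = (fun k => c k - series eps k) + series eps.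
    by apply/funext => k; rewrite fctE/= subrK.
  exact: is_cvgD.
split=> //.
- have c1 : c k.+1 @[k --> \oo] --> limn c.
    by rewrite cvg_shiftS.
  have up : (c k + eps k - c k.+1) @[k --> \oo] --> limn c + 0 - limn c.
    by apply: cvgB => //; apply: cvgD.
  rewrite addr0 subrr in up.
  apply: (squeeze_cvgr _ (cvg_cst 0) up); apply: nearW => k.
  by rewrite r0/=; have := dec k; lra.
- exists (c 0%N + S) => k.
  have eps_0 : series eps 0%N = 0 by rewrite /series/= big_geq.
  by have := d_decr 0%N k (leq0n k); have := epsS k; rewrite eps_0; lra.
Qed.

(** The filter counterpart of subsequence extraction: a cluster point of [u]
    along [F] is a limit of [u] along a finer filter. *)
Lemma cluster_finer {T : Type} {X : topologicalType} (F : set_system T)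
  {FF : ProperFilter F} (u : T -> X) (p : X) :
  cluster (u @ F) p ->
  exists G : set_system T, [/\ ProperFilter G, F `<=` G & u @ G --> p].
Proof.
move=> clp.
(* The sets [u @^-1` A `&` C], with [A] a neighbourhood of [p] and [C] in [F],
   form a basis of the required filter. *)
pose D := [set AB : set X * set T | nbhs p AB.1 /\ F AB.2].
pose B (AB : set X * set T) := u @^-1` AB.1 `&` AB.2.
exists (filter_from D B); split.
- apply: filter_from_proper.
    apply: filter_from_filter.
      by exists (setT, setT); split; exact: filterT.
    move=> [A1 B1] [A2 B2] [/= pA1 FB1] [/= pA2 FB2].
    exists (A1 `&` A2, B1 `&` B2); first by split; exact: filterI.
    by move=> t [[/= ? ?] [/= ? ?]]; split; split.
  move=> [A C] [/= pA FC].
  have [|_ [[t Ct <-] At]] := clp (u @` C) A _ pA.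
    rewrite nbhs_filterE fmapE.
    by apply: filterS FC => t Ct; exists t.
  by exists t.
- move=> C FC; exists (setT, C); first by split => //; exact: filterT.
  by move=> t [].
- move=> A pA; exists (A, setT); first by split => //; exact: filterT.
  by move=> t [].
Qed.

End Sequences.

(** * Convergence of row vectors *)

Section RowConvergence.
Context {R : realType} {n : nat} {T : Type} {F : set_system T} {FF : Filter F}.

Lemma cvg_dotp (u v : T -> 'rV[R]_n) (a b : 'rV[R]_n) :
  u @ F --> a -> v @ F --> b -> dotp (u t) (v t) @[t --> F] --> dotp a b.
Proof.
move=> ua vb; apply: cvg_big => [|i _]; last first.
  have coord (w : T -> 'rV[R]_n) (c : 'rV[R]_n) :
      w @ F --> c -> w t 0 i @[t --> F] --> c 0 i.
    move=> wc; apply: (cvg_comp _ (fun m : 'rV[R]_n => m 0 i) wc).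
    exact: coord_continuous.
  by apply: cvgM; exact: coord.
exact: add_continuous.
Qed.

Lemma cvg0_dotp_le (u : T -> 'rV[R]_n) (r : T -> R) :
  (forall t, dotp (u t) (u t) <= r t) -> r @ F --> 0 ->
  u @ F --> (0 : 'rV[R]_n).
Proof.
move=> ur r0; apply: norm_cvg0.
have sr0 : Num.sqrt (r t) @[t --> F] --> (0 : R).
  rewrite -[0 in X in _ --> X](sqrtr0 R).
  by apply: (cvg_comp _ _ r0); exact: sqrt_continuous.
apply: (squeeze_cvgr _ (cvg_cst 0) sr0); apply: nearW => t.
by rewrite normr_ge0/= (le_trans (normr_le_enorm _))// ler_wsqrtr.
Qed.

End RowConvergence.

(** * Compactness of balls *)

Section Balls.
Context {R : realType} {n : nat}.

Lemma compact_normball (r : R) : compact [set x : 'rV[R]_n | `|x| <= r].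
Proof.
apply: bounded_closed_compact.
  exists r; split; first exact: num_real.
  by move=> M rM x /= /le_trans; apply; exact: ltW.
apply: (@closed_comp _ _ (fun x : 'rV[R]_n => `|x|) [set t : R | t <= r]).
  by move=> x _; exact: norm_continuous.
exact: closed_le.
Qed.

Lemma bounded_cluster {T : Type} {F : set_system T} {FF : ProperFilter F}
    (u : T -> 'rV[R]_n) (r : R) : (forall t, `|u t| <= r) ->
  exists p, cluster (u @ F) p.
Proof.
move=> ur.
have [|p [_ ?]] := compact_normball r _ (fmap_proper_filter u FF).
  by apply: nearW => t; exact: ur.
by exists p.
Qed.

Lemma continuous_bounded_on_ball (g : 'rV[R]_n -> R) (r : R) :
  continuous g -> exists C, forall x, `|x| <= r -> `|g x| <= C.
Proof.
move=> gc.
have gA : compact (g @` [set x | `|x| <= r]).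
  apply: continuous_compact; last exact: compact_normball.
  exact: continuous_subspaceT.
have [M [_ MA]] := compact_bounded gA.
exists (M + 1) => x xr; apply: (MA (M + 1)); first by rewrite ltrDl.
by exists x.
Qed.

End Balls.

(** * Subgradients and their limits *)

Section Subgradients.
Context {R : realType} {n : nat}.
Implicit Types (f : 'rV[R]_n -> \bar R) (g : 'rV[R]_n -> R).
Implicit Types (x y d : 'rV[R]_n).

Lemma subdiff_EFinP g x y :
  subdiff (EFin \o g) x y <-> forall z, g x + dotp y (z - x) <= g z.
Proof.
by split => H z; have := H z; rewrite /= sube0 -EFinD lee_fin.
Qed.

(** Subgradients of a continuous function are bounded over balls: tested at
    unit steps along the coordinate axes, which stay in a concentric ball where
    the function is bounded, the subgradient inequality bounds each
    coordinate. *)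
Lemma subdiff_bounded g (r : R) : continuous g ->
  exists C, forall x y, `|x| <= r -> subdiff (EFin \o g) x y -> `|y| <= C.
Proof.
move=> gc.
have [C gC] := continuous_bounded_on_ball _ (r + 1) gc.
exists (2 * C) => x y xr /subdiff_EFinP gy.
have [->|y0] := eqVneq y 0.
  by rewrite normr0 mulr_ge0// (le_trans _ (gC x _))// (le_trans xr)// lerDl.
have [j yj] := normr_row_attained _ y0.
have gx : `|g x| <= C by apply: gC; rewrite (le_trans xr)// lerDl.
have delta1 : `|delta_mx 0 j : 'rV[R]_n| <= 1.
  rewrite (le_trans (normr_le_enorm _))// /enorm dotp_delta mxE !eqxx.
  by rewrite sqrtr1.
have step (s : R) : `|s| = 1 -> s * y 0 j <= 2 * C.
  move=> s1; have := gy (x + s *: delta_mx 0 j).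
  rewrite addrAC subrr add0r dotpZr dotp_delta.
  have : `|g (x + s *: delta_mx 0 j)| <= C.
    apply: gC; rewrite (le_trans (ler_normD _ _))// lerD//.
    by rewrite normrZ s1 mul1r.
  by move: gx; rewrite !ler_norml; lra.
rewrite yj ler_norml; apply/andP; split.
  by have := step (-1) (normrN1 _); lra.
by have := step 1 (normr1 _); lra.
Qed.

Lemma subdiff_closed {T : Type} {F : set_system T} {FF : ProperFilter F} g
    (u v : T -> 'rV[R]_n) x y : continuous g ->
  u @ F --> x -> v @ F --> y -> (forall t, subdiff (EFin \o g) (u t) (v t)) ->
  subdiff (EFin \o g) x y.
Proof.
move=> gc ux vy uv; apply/subdiff_EFinP => z.
have gux : g (u t) @[t --> F] --> g x by apply: (cvg_comp _ _ ux); exact: gc.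
have lim : (g (u t) + dotp (v t) (z - u t)) @[t --> F] -->
    g x + dotp y (z - x).
  apply: cvgD => //; apply: cvg_dotp => //.
  by apply: cvgB => //; exact: cvg_cst.
apply: (closed_cvg (fun a : R => a <= g z) _ _ _ lim); first exact: closed_le.
by apply: nearW => t; move/subdiff_EFinP: (uv t); exact.
Qed.

Lemma fineK_edom f x : proper_fun f -> edom f x -> (fine (f x))%:E = f x.
Proof.
move=> f_proper fx; rewrite fineK// fin_numE; apply/andP; split.
  by rewrite gt_eqF//; case: f_proper.
by rewrite lt_eqF.
Qed.

Lemma eps_subdiff_fine f delta x d z : proper_fun f -> edom f x -> edom f z ->
  eps_subdiff f delta x d ->
  fine (f x) + dotp d (z - x) - delta <= fine (f z).
Proof.
move=> pf fx fz /(_ z); rewrite -(fineK_edom _ _ pf fx) -(fineK_edom _ _ pf fz).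
by rewrite lee_fin.
Qed.

(** Limits of approximate subgradients of a proper closed function, when the
    errors vanish and the values converge: closedness of the epigraph bounds
    the value at the limit point from above, and the subgradient inequality
    tested at the limit point itself bounds it from below. *)
Lemma eps_subdiff_closed {T : Type} {F : set_system T} {FF : ProperFilter F}
    f (u v : T -> 'rV[R]_n) (del : T -> R) x d (phi : R) :
  proper_fun f -> closed_fun f -> (forall t, edom f (u t)) ->
  (forall t, eps_subdiff f (del t) (u t) (v t)) ->
  u @ F --> x -> v @ F --> d -> del @ F --> (0 : R) ->
  fine (f (u t)) @[t --> F] --> phi ->
  f x = phi%:E /\ subdiff f x d.
Proof.
move=> f_proper f_closed fu fuv ux vd del0 fphi.
have f_le_phi : (f x <= phi%:E)%E.
  apply: (closed_cvg (fun p : 'rV[R]_n * R => (f p.1 <= p.2%:E)%E)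
      f_closed _ (x, phi) (cvg_pair ux fphi)).
  by apply: nearW => t /=; rewrite fineK_edom.
have fx : edom f x by apply: le_lt_trans f_le_phi _; exact: ltry.
have phi_sub z : edom f z -> phi + dotp d (z - x) <= fine (f z).
  move=> fz.
  have lim : (fine (f (u t)) + dotp (v t) (z - u t) - del t) @[t --> F]
      --> phi + dotp d (z - x) - 0.
    apply: cvgB => //; apply: cvgD => //; apply: cvg_dotp => //.
    by apply: cvgB => //; exact: cvg_cst.
  rewrite subr0 in lim.
  apply: (closed_cvg (fun a : R => a <= fine (f z)) _ _ _ lim).
    exact: closed_le.
  by apply: nearW => t; exact: eps_subdiff_fine.
have fE : f x = phi%:E.
  rewrite -fineK_edom//; congr (_%:E); apply: le_anti.
  rewrite -lee_fin fineK_edom// f_le_phi/=.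
  by have := phi_sub _ fx; rewrite subrr dotp0r addr0.
split=> // z; rewrite fE sube0.
case fz : (f z) => [a| |]; last 2 first.
- by rewrite leey.
- by have [/(_ z)] := f_proper; rewrite fz.
- rewrite -EFinD lee_fin.
  by have := phi_sub z; rewrite /edom /= fz ltry; exact.
Qed.

End Subgradients.

(** * One step of the algorithm *)

Section Step.
Context {R : realType} {n : nat}.
Implicit Types (f : 'rV[R]_n -> \bar R) (h g : 'rV[R]_n -> R).

Lemma ratio_mulg f h g x :
  Omega g x -> Defs.ratio f h g x * g x = fine (f x) + h x.
Proof. by move=> gx; rewrite /Defs.ratio divfK. Qed.

(** The basic decrease estimate, in a form cleared of the denominator [g x'].
    It adds up the descent lemma for [h], the subgradient inequality of [g] at
    [x] tested at [x'] and multiplied by the current ratio, and the approximate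
    subgradient inequality of [f] at [x'] tested at [x]. *)
Lemma step_decrease f h g (L gam eps delta : R) (H : 'M[R]_n)
    (x x' y Delta d : 'rV[R]_n) :
  proper_fun f -> (forall x, differentiable h x) -> 0 < L ->
  (forall x y, enorm (gradient h x - gradient h y) <= L * enorm (x - y)) ->
  loewner_le gam%:M H ->
  (Omega g `&` edom f) x -> (Omega g `&` edom f) x' ->
  0 <= Defs.ratio f h g x ->
  subdiff (EFin \o g) x y -> eps_subdiff f delta x' d ->
  Delta = d + gradient h x - Defs.ratio f h g x *: y + (x' - x) *m H^T ->
  enorm Delta ^+ 2 + `|dotp Delta (x' - x)| + delta <= eps * g x' ->
  Defs.ratio f h g x' * g x' + (gam - L / 2) * dotp (x' - x) (x' - x) <=
  (Defs.ratio f h g x + eps) * g x'.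
Proof.
move=> f_proper dh L0 hL gamH [gx fx] [gx' fx'] c0.
move=> /subdiff_EFinP/(_ x') gy fd DeltaE err.
have fxx' := eps_subdiff_fine _ _ _ _ _ f_proper fx' fx fd.
have := descent_lemma _ _ dh L0 hL x (x' - x).
rewrite (addrC x) subrK ratio_mulg// => hx'.
have := ratio_mulg f h _ _ gx.
move: c0 DeltaE; set c := Defs.ratio f h g x => c0 DeltaE cgx.
have dE : d = Delta - gradient h x + c *: y - (x' - x) *m H^T.
  rewrite DeltaE; apply/rowP => i; rewrite !mxE; ring.
rewrite -(opprB x' x) dotpNr in fxx'.
set s := x' - x in dE fxx' gy err hx' *.
rewrite dE !(dotpDl, dotpNl) dotpZl (dotpC (s *m H^T)) in fxx'.
have := loewner_lower _ _ s gamH.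
have := ler_wpM2l c0 gy.
have := sqr_ge0 (enorm Delta).
have := ler_norm (dotp Delta s).
move: fxx' hx' err cgx; lra.
Qed.

End Step.

Theorem theorem3p1 (R : realType) (n : nat)
    (f : 'rV[R]_n -> \bar R) (h g : 'rV[R]_n -> R) (Lh : R)
    (Omega_neq0 : Omega g !=set0)
    (f_proper : proper_fun f) (f_closed : closed_fun f) (f_convex : econvex f)
    (h_C1 : continuously_differentiable h)
    (Lh_gt0 : 0 < Lh)
    (h_Lipschitz : forall x y : 'rV[R]_n,
       enorm (gradient h x - gradient h y) <= Lh * enorm (x - y))
    (g_cont : continuous g) (g_convex : convex_function setT g)
    (g_ge0 : forall x, edom f x -> 0 <= g x)
    (fh_ge0 : forall x, edom f x -> (0 <= f x + (h x)%:E)%E)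
    (fh_gt0 : forall x, g x = 0 -> (0 < f x + (h x)%:E)%E)
    (F_level_bounded : level_bounded (objective f h g))
    (eps : nat -> R) (H : nat -> 'M[R]_n)
    (eps_ge0 : forall k, 0 <= eps k)
    (H_posdef : forall k, posdefmx (H k))
    (eps_summable : (\sum_(0 <= k <oo) (eps k)%:E < +oo)%E)
    (H_bounds : exists gamma_lo gamma_hi : R,
       [/\ 0 < gamma_lo, 0 < gamma_hi, Lh / 2 < gamma_lo,
           gamma_lo <= gamma_hi &
           forall k, loewner_le gamma_lo%:M (H k) /\
                     loewner_le (H k) gamma_hi%:M])
    (x : nat -> 'rV[R]_n)
    (x_generated : iVPGSA_sequence f h g eps H x)
    (xstar : 'rV[R]_n) :
  cluster (x @ \oo) xstar -> critical_point f h g xstar.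
Proof.
move=> x_cluster.
have [x0_dom x_step] := x_generated.
have [lo [hi [lo0 hi0 Llo _ HH]]] := H_bounds.
have [dh gradh_cont] := h_C1.
have x_dom k : (Omega g `&` edom f) (x k).
  by case: k => // k; have [? [? [? []]]] := x_step k.
have gx_gt0 k : 0 < g (x k).
  by have [gx fx] := x_dom k; rewrite lt_neqAle eq_sym g_ge0 ?andbT.
pose c k := Defs.ratio f h g (x k).
pose s k := x k.+1 - x k.
have c_ge0 k : 0 <= c k.
  apply: divr_ge0; last exact: ltW.
  by have [_ fx] := x_dom k; rewrite -lee_fin EFinD fineK_edom// fh_ge0.
(* [w] packs the subgradient of [g] and the error pair of a step; the inclusion
   then determines the approximate subgradient of [f]. *)
have {}x_step k : exists w : 'rV[R]_n * 'rV[R]_n * R,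
    [/\ subdiff (EFin \o g) (x k) w.1.1, 0 <= w.2,
      eps_subdiff f w.2 (x k.+1)
        (w.1.2 - gradient h (x k) + c k *: w.1.1 - s k *m (H k)^T) &
      enorm w.1.2 ^+ 2 + `|dotp w.1.2 (s k)| + w.2 <= eps k * g (x k.+1)].
  have [y [D [del [gy _ del0 [d fd DE] err]]]] := x_step k.
  exists (y, D, del); split => //=.
  suff <- : d = D - gradient h (x k) + c k *: y - s k *m (H k)^T by [].
  by rewrite -DE; apply/rowP => i; rewrite !mxE; ring.
have [w /all_and4[gy del_ge0 fd err]] := choice x_step.
pose y k := (w k).1.1; pose D k := (w k).1.2; pose del k := (w k).2.
pose d k := D k - gradient h (x k) + c k *: y k - s k *m (H k)^T.
pose r k := (lo - Lh / 2) * dotp (s k) (s k) / g (x k.+1).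
have r_ge0 k : 0 <= r k.
  by rewrite divr_ge0 ?(ltW (gx_gt0 _))// mulr_ge0 ?dotp_ge0// subr_ge0 ltW.
have c_decrease k : c k.+1 + r k <= c k + eps k.
  have rE : r k * g (x k.+1) = (lo - Lh / 2) * dotp (s k) (s k).
    by rewrite /r divfK ?gt_eqF.
  rewrite -(ler_pM2r (gx_gt0 k.+1)) mulrDl rE.
  apply: (step_decrease _ _ _ Lh lo (eps k) (del k) (H k)
      _ _ (y k) (D k) (d k)) => //.
  - by have [] := HH k.
  - exact: c_ge0.
  - exact: fd.
  - rewrite -/(s k) -/(c k) /d; move: (s k *m _) => v.
    by apply/rowP => i; rewrite !mxE; ring.
  - exact: err.
have [c_cvg eps_cvg r_cvg [C cC]] :=
  quasi_decrease_cvg _ _ _ c_ge0 r_ge0 eps_ge0 eps_summable c_decrease.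
(* All the iterates lie in the sublevel set of the objective at height [C]. *)
have [rho xrho] : exists rho, forall k, `|x k| <= rho.
  have [M [_ MC]] := F_level_bounded C.
  exists (M + 1) => k; apply: (MC (M + 1)); first by rewrite ltrDl.
  rewrite /= /objective; case: asboolP => [_|[]]; first by rewrite lee_fin cC.
  by have [] := x_dom k.
have [K gK] := continuous_bounded_on_ball _ rho g_cont.
have gxK k : g (x k) <= K by apply: (le_trans (ler_norm _)); exact: gK.
have [Y yY] := subdiff_bounded _ rho g_cont.
have {}yY k : `|y k| <= Y by apply: yY (gy k); exact: xrho.
have err_bound k : dotp (D k) (D k) <= eps k * K /\ del k <= eps k * K.
  have := ler_wpM2l (eps_ge0 k) (gxK k.+1); have := err k.
  rewrite -/(D k) -/(del k) enorm_sqr.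
  have := normr_ge0 (dotp (D k) (s k)); have := dotp_ge0 (D k).
  have := del_ge0 k; rewrite -/(del k); lra.
have epsK_cvg : (eps k * K) @[k --> \oo] --> (0 : R).
  by rewrite -(mul0r K); apply: cvgMl.
have D_cvg : D @ \oo --> (0 : 'rV[R]_n).
  by apply: cvg0_dotp_le epsK_cvg => k; have [] := err_bound k.
have del_cvg : del @ \oo --> (0 : R).
  apply: (squeeze_cvgr _ (cvg_cst 0) epsK_cvg); apply: nearW => k.
  by have [_ ->] := err_bound k; rewrite andbT; exact: del_ge0.
have ss_bound k : dotp (s k) (s k) <= r k * (K / (lo - Lh / 2)).
  have lo' : 0 < lo - Lh / 2 by rewrite subr_gt0.
  rewrite mulrA ler_pdivlMr// (mulrC (dotp _ _)).
  rewrite -[leLHS](divfK (lt0r_neq0 (gx_gt0 k.+1))) -/(r k).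
  by rewrite ler_wpM2l.
have s_cvg : s @ \oo --> (0 : 'rV[R]_n).
  apply: cvg0_dotp_le ss_bound _.
  by rewrite -(mul0r (K / (lo - Lh / 2))); apply: cvgMl.
have Hs_cvg : (s k *m (H k)^T) @[k --> \oo] --> (0 : 'rV[R]_n).
  apply: (cvg0_dotp_le _ (fun k => r k * (hi ^+ 2 * (K / (lo - Lh / 2))))).
    move=> k; rewrite mulrCA; have [_ Hhi] := HH k.
    apply: (le_trans (posdef_mulmx_le _ _ (s k) hi0 (H_posdef k) Hhi)).
    by rewrite ler_wpM2l// sqr_ge0.
  by rewrite -(mul0r (hi ^+ 2 * (K / (lo - Lh / 2)))); apply: cvgMl.
(* Along a common refinement [F] of [\oo], the iterates converge to [xstar]
   and the subgradients [y k] of [g] to some [ystar]. *)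
have [F0 [F0_proper F0oo x_F0]] := cluster_finer _ _ _ x_cluster.
have [ystar y_cluster] := bounded_cluster (F := F0) y Y yY.
have [F [F_proper F_F0 y_F]] := cluster_finer _ _ _ y_cluster.
have Foo : \oo `<=` F by move=> A /F0oo/F_F0.
have to_F (X : topologicalType) (u : nat -> X) (p : X) :
    u @ \oo --> p -> u @ F --> p.
  by move=> up A /up/Foo.
have x_F : x @ F --> xstar by move=> A /x_F0/F_F0.
have x1_F : x k.+1 @[k --> F] --> xstar.
  have -> : (fun k => x k.+1) = (fun k => s k + x k).
    by apply/funext => k; rewrite subrK.
  by rewrite -[xstar]add0r; apply: cvgD => //; exact: to_F.
have c_F := to_F _ _ _ c_cvg.
have c1_F : c k.+1 @[k --> F] --> limn c by apply: to_F; rewrite cvg_shiftS.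
set cstar := limn c in c_F c1_F *.
have ystar_sub : subdiff (EFin \o g) xstar ystar.
  exact: (subdiff_closed _ _ _ _ _ g_cont x_F y_F).
pose u := cstar *: ystar - gradient h xstar.
have d_F : d @ F --> u.
  have -> : u = 0 - gradient h xstar + cstar *: ystar - 0.
    by rewrite subr0 sub0r addrC.
  apply: cvgB; last exact: to_F.
  apply: cvgD; last exact: cvgZ.
  apply: cvgB; first exact: to_F.
  by apply: (cvg_comp _ _ x_F); exact: gradh_cont.
(* [f (x k.+1) + h (x k.+1) = c k.+1 * g (x k.+1)], so the values of [f]
   converge; that [phi] is the value of [f] at [xstar] is proved below. *)
pose phi := cstar * g xstar - h xstar.
have f_F : fine (f (x k.+1)) @[k --> F] --> phi.
  have -> : (fun k => fine (f (x k.+1))) =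
      (fun k => c k.+1 * g (x k.+1) - h (x k.+1)).
    apply/funext => k; have [gx _] := x_dom k.+1.
    by rewrite /c ratio_mulg// addrK.
  apply: cvgB; first apply: cvgM => //.
    by apply: (cvg_comp _ _ x1_F); exact: g_cont.
  by apply: (cvg_comp _ _ x1_F); exact: (differentiable_continuous (dh xstar)).
have [fE u_sub] : f xstar = phi%:E /\ subdiff f xstar u.
  apply: (eps_subdiff_closed (F := F) _ (fun k => x k.+1) d del) => //.
  - by move=> k; have [] := x_dom k.+1.
  - exact: to_F.
(* If [g] vanished at [xstar], so would [f + h], since
   [f xstar + h xstar = cstar * g xstar]. *)
have gxstar : g xstar != 0.
  apply/eqP => g0; have := fh_gt0 _ g0.
  by rewrite fE -EFinD lte_fin /phi g0 mulr0 sub0r addNr ltxx.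
have objE : objective f h g xstar = cstar%:E.
  rewrite /objective; case: asboolP => [_|[]]; last first.
    by split => //; rewrite /edom /= fE ltry.
  by rewrite /Defs.ratio fE /= /phi subrK mulfK.
split; first by rewrite /edom /= objE ltry.
exists u, ystar; split => //.
by rewrite objE /= /u subrK subrr.
Qed.
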